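(* Let $f\colon\mathbb{R}^d\to\mathbb{R}\cup\{\infty\}$ be a lower semicontinuous convex function, let $Q\subseteq\mathbb{R}^d$ be a nonempty closed convex set contained in the domain of $f$, and assume the set $X^*$ of minimizers of $f$ over $Q$ is nonempty, with minimum value $f^*$. Suppose $f$ is $\mu$-strongly convex on $Q$ for some $\mu>0$. Let $g(x;\xi)$ be a stochastic subgradient oracle with $\mathbb{E}_{\xi\sim D}\,g(x;\xi)\in\partial f(x)$ for all $x\in Q$, and suppose there are constants $L_0,L_1\ge0$ with $$\mathbb{E}_{\xi}\|g(x;\xi)\|^2\le L_0^2+L_1(f(x)-f^* )\qquad\text{for all }x\in Q.$$ Fix $x^*\in X^*$, $x_0\in Q$, and consider $x_{k+1}=P_Q(x_k-\alpha_kg(x_k;\xi_k))$ with $\xi_k\sim D$ i.i.d. and $$\alpha_k=\frac{2}{\mu(k+2)+\frac{L_1^2}{\mu(k+1)}}.$$ Then for every $T\ge0$, $$\mathbb{E}_{\xi_{0\dots T}}\left[f\left(\frac{\sum_{k=0}^T(k+1)(2-L_1\alpha_k)x_k}{\sum_{k=0}^T(k+1)(2-L_1\alpha_k)}\right)-f^*\right]\le\frac{2L_0^2(T+1)+L_1^2\|x_0-x^*\|^2/2}{\mu\sum_{k=0}^T(k+1)(2-L_1\alpha_k)},$$ and also $$\mathbb{E}_{\xi_{0\dots T}}\left[f\left(\frac{2}{(T+1)(T+2)}\sum_{k=0}^T(k+1)x_k\right)-f^*\right]\le\frac{4L_0^2}{\mu(T+2)}+\frac{L_1^2\|x_0-x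^*\|^2}{\mu(T+1)(T+2)}.$$
   Context: $f$ is $\mu$-strongly convex on $Q$ if for every $x\in Q$ and $g\in\partial f(x)$, $f(y)\ge f(x)+g^T(y-x)+\frac{\mu}{2}\|y-x\|^2$ for all $y\in Q$. $P_Q$ is orthogonal projection onto $Q$; $\partial f(x)=\{g: f(y)\ge f(x)+g^T(y-x)\ \forall y\in\mathbb{R}^d\}$; $\mathbb{E}_{\xi_{0\dots T}}$ is expectation over the i.i.d. samples $\xi_0,\dots,\xi_T$. *)

(* Defs.v *)
From HB Require Import structures.
From mathcomp Require Import all_boot all_order all_algebra.
From mathcomp Require Import all_classical all_reals all_analysis.
Set Implicit Arguments. Unset Strict Implicit. Unset Printing Implicit Defensive.
Import Order.TTheory GRing.Theory Num.Theory.
Import numFieldNormedType.Exports.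
Local Open Scope classical_set_scope.
Local Open Scope ring_scope.

Section Defs.
Context {R : realType} {d : nat}.
Notation V := 'rV[R]_d.

Definition dotp (u v : V) : R := \sum_(i < d) u ord0 i * v ord0 i.
Definition sqnorm (u : V) : R := dotp u u.

Definition ext_convex (f : V -> \bar R) :=
  forall (x y : V) (t : R), 0 <= t <= 1 ->
    (f (t *: x + (1 - t) *: y)%R <= t%:E * f x + (1 - t)%R%:E * f y)%E.

Definition convex_subset (Q : set V) :=
  forall (x y : V) (t : R), Q x -> Q y -> 0 <= t <= 1 -> Q (t *: x + (1 - t) *: y).

Definition subdiff (f : V -> \bar R) (x : V) : set V :=
  [set s | forall y : V, (f x + (dotp s (y - x)%R)%:E <= f y)%E].

Definition strongly_convex_on (mu : R) (Q : set V) (f : V -> \bar R) :=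
  forall (x s : V), Q x -> subdiff f x s -> forall y : V, Q y ->
    (f x + (dotp s (y - x) + mu / 2 * sqnorm (y - x))%R%:E <= f y)%E.

Definition is_orth_proj (Q : set V) (proj : V -> V) :=
  forall x : V, Q (proj x) /\ forall y : V, Q y -> sqnorm (x - proj x) <= sqnorm (x - y).

Section Oracle.
Context {dX : measure_display} {X : measurableType dX}.

(* joint measurability of the oracle (x, xi) |-> g(x; xi) w.r.t.
   Borel(R^d) (x) (sigma-algebra of X), componentwise *)
Definition oracle_measurable (g : V -> X -> V) :=
  forall (i : 'I_d) (B : set R), measurable B ->
    <<s [set C | exists U A, open U /\ measurable A /\ C = U `*` A] >>
      [set p : V * X | B (g p.1 p.2 ord0 i)].

Definition oracle_mean (D : probability X R) (g : V -> X -> V) (x : V) : V :=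
  \row_(i < d) Rintegral D setT (fun xi => g x xi ord0 i).

Definition oracle_integrable (D : probability X R) (g : V -> X -> V) (x : V) :=
  forall i : 'I_d, D.-integrable setT (fun xi => (g x xi ord0 i)%:E).

Definition iid_seq {dO : measure_display} {O : measurableType dO}
  (P : probability O R) (D : probability X R) (xi : nat -> O -> X) :=
  (forall k, measurable_fun setT (xi k)) /\
  forall (n : nat) (A : nat -> set X), (forall i, measurable (A i)) ->
    P (\bigcap_(i < n) (xi i @^-1` A i)) = (\prod_(i < n) D (A i))%E.

Fixpoint psgd (proj : V -> V) (g : V -> X -> V) (alpha : nat -> R) (x0 : V)
    (s : nat -> X) (k : nat) : V :=
  match k with
  | 0 => x0
  | k'.+1 => let x := psgd proj g alpha x0 s k' in proj (x - alpha k' *: g x (s k'))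
  end.

End Oracle.

Definition step (mu L1 : R) (k : nat) : R :=
  2 / (mu * (k.+2)%:R + L1 ^+ 2 / (mu * (k.+1)%:R)).

End Defs.

(* Main.v *)
Require Import Defs.
From HB Require Import structures.
From mathcomp Require Import all_boot all_order all_algebra.
From mathcomp Require Import all_classical all_reals all_analysis.
From mathcomp Require Import measurable_realfun.
From mathcomp Require Import ring lra.
Import Order.TTheory GRing.Theory Num.Theory.
Import numFieldNormedType.Exports.
Local Open Scope classical_set_scope.
Local Open Scope ring_scope.

(* With a_k = step k, d_k = |x_k - x*|^2 and gap_k = f(x_k) - f*, nonexpansiveness
   of the projection, strong convexity and the second moment bound give
     E d_(k+1) + a_k (2 - L1 a_k) E gap_k <= (1 - mu a_k) E d_k + a_k^2 L0^2,
   using that x_k depends only on xi_0, ..., xi_(k-1) and so is independent of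
   xi_k. Multiplied by (k+1) / a_k = (mu (k+1) (k+2) + L1^2 / mu) / 2 this
   telescopes, because (k+1) (1 / a_k - mu) = k / a_(k-1) for k > 0, with value
   L1^2 / (2 mu) for k = 0; moreover (k+1) a_k <= 2 / mu. Jensen's inequality
   passes to the averages, the second bound following from L1 a_k <= 1, i.e.
   k+1 <= (k+1) (2 - L1 a_k). The recursion is kept in nonnegative
   extended reals, so no integrability of d_k or gap_k has to be established
   beforehand. *)

(** * Euclidean geometry and projection onto a convex set *)

Section euclidean.
Context {R : realType} {d : nat}.
Implicit Types (u v w x y z : 'rV[R]_d) (a t : R) (Q : set 'rV[R]_d).

Lemma dotpC u v : dotp u v = dotp v u.
Proof. by apply: eq_bigr => i _; rewrite mulrC. Qed.

Lemma dotpDl u v w : dotp (u + v) w = dotp u w + dotp v w.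
Proof. by rewrite -big_split; apply: eq_bigr => i _; rewrite mxE mulrDl. Qed.

Lemma dotpZl a u v : dotp (a *: u) v = a * dotp u v.
Proof. by rewrite mulr_sumr; apply: eq_bigr => i _; rewrite mxE mulrA. Qed.

Lemma dotpNl u v : dotp (- u) v = - dotp u v.
Proof. by rewrite -scaleN1r dotpZl mulN1r. Qed.

Lemma dotpNr u v : dotp u (- v) = - dotp u v.
Proof. by rewrite dotpC dotpNl dotpC. Qed.

Lemma dotpZr a u v : dotp u (a *: v) = a * dotp u v.
Proof. by rewrite dotpC dotpZl dotpC. Qed.

Lemma sqnorm_ge0 u : 0 <= sqnorm u.
Proof. by apply: sumr_ge0 => i _; rewrite -expr2 sqr_ge0. Qed.

Lemma sqnormN u : sqnorm (- u) = sqnorm u.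
Proof. by rewrite /sqnorm dotpNl dotpNr opprK. Qed.

Lemma sqnormZ a u : sqnorm (a *: u) = a ^+ 2 * sqnorm u.
Proof. by rewrite /sqnorm dotpZl dotpZr mulrA. Qed.

Lemma sqnormB u v : sqnorm (u - v) = sqnorm u - 2 * dotp u v + sqnorm v.
Proof.
by rewrite /sqnorm dotpDl dotpNl dotpC [dotp v _]dotpC !dotpDl !dotpNl
   (dotpC v u); ring.
Qed.

Lemma sqr_coord_le_sqnorm u i : u ord0 i ^+ 2 <= sqnorm u.
Proof.
rewrite /sqnorm /dotp (bigD1 i)//= expr2 lerDl.
by apply: sumr_ge0 => j _; rewrite -expr2 sqr_ge0.
Qed.

Context {Q : set 'rV[R]_d} {proj : 'rV[R]_d -> 'rV[R]_d}.
Hypotheses (cvxQ : convex_subset Q) (projP : is_orth_proj Q proj).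

(** Were the inner product positive, a short move from [proj z] towards [y] would stay in [Q] by
    convexity and come strictly closer to [z]. *)
Lemma orth_proj_obtuse z y : Q y -> dotp (z - proj z) (y - proj z) <= 0.
Proof.
move=> Qy; have [Qp pmin] := projP z.
set p := proj z in Qp pmin *; set c := dotp _ _; set s := sqnorm (y - p).
rewrite leNgt; apply/negP => c0.
have s0 : 0 <= s := sqnorm_ge0 _.
have sc0 : 0 < s + c by rewrite ltr_wpDl.
(* This [t] lies in []0, 1]] and satisfies [t * s <= c], so the first-order gain [2 * t * c] exceeds
   the second-order cost [t ^+ 2 * s]. *)
pose t := c / (s + c).
have t0 : 0 < t by rewrite divr_gt0.
have t1 : t <= 1 by rewrite ler_pdivrMr// mul1r lerDr.
have ts : t * s <= c.
  by rewrite /t mulrAC ler_pdivrMr// ler_pM2l// lerDl ltW.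
have t01 : 0 <= t <= 1 by rewrite (ltW t0).
have := pmin _ (cvxQ _ _ _ Qy Qp t01).
have -> : z - (t *: y + (1 - t) *: p) = (z - p) - t *: (y - p).
  by apply/rowP => i; rewrite !mxE; ring.
rewrite [leRHS]sqnormB dotpZr sqnormZ -/c -/s => le0.
have : t * (2 * c) <= t * (t * s) by lra.
by rewrite ler_pM2l//; lra.
Qed.

Lemma orth_proj_sqnorm_le z y : Q y -> sqnorm (proj z - y) <= sqnorm (z - y).
Proof.
move=> Qy; have obt := orth_proj_obtuse z y Qy.
have -> : z - y = (z - proj z) - (y - proj z).
  by apply/rowP => i; rewrite !mxE; ring.
rewrite [leRHS]sqnormB -sqnormN opprB.
have := sqnorm_ge0 (z - proj z); lra.
Qed.

(** Adding the obtuse-angle inequalities at [x] and at [y] gives firm nonexpansiveness;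
    nonnegativity of the squared norm of [(x - y) - (proj x - proj y)] then yields the claim. *)
Lemma orth_proj_nonexpansive x y : sqnorm (proj x - proj y) <= sqnorm (x - y).
Proof.
have obx := orth_proj_obtuse x (proj y) (projP y).1.
have oby := orth_proj_obtuse y (proj x) (projP x).1.
have : dotp (x - y) (proj x - proj y) >= sqnorm (proj x - proj y).
  rewrite -subr_ge0.
  suff <- : - (dotp (x - proj x) (proj y - proj x) +
            dotp (y - proj y) (proj x - proj y)) =
         dotp (x - y) (proj x - proj y) - sqnorm (proj x - proj y) by lra.
  rewrite -(opprB (proj x) (proj y)) dotpNr -(opprB (proj x) x).
  rewrite -[y - proj y]opprB /sqnorm !(dotpDl, dotpNl); ring.
have := sqnorm_ge0 ((x - y) - (proj x - proj y)).
by rewrite sqnormB; lra.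
Qed.

Lemma orth_proj_continuous : continuous proj.
Proof.
move=> x A /nbhs_ballP[e /= e0 eA].
(* Balls are sup-norm balls, while nonexpansiveness is Euclidean: [d] coordinates below [e / d.+1]
   have squares summing to less than [e ^+ 2], also for [d = 0]. *)
have d0 : 0 < e / d.+1%:R by rewrite divr_gt0// ltr0n.
apply/nbhs_ballP; exists (e / d.+1%:R) => //= y xy.
have sq_lt : sqnorm (x - y) < e ^+ 2.
  have : sqnorm (x - y) <= d%:R * (e / d.+1%:R) ^+ 2.
    rewrite /sqnorm /dotp -[d in d%:R]card_ord -sumr_const mulr_suml.
    apply: ler_sum => i _; rewrite mul1r -expr2 !mxE.
    rewrite -[leLHS]real_normK ?num_real// lerXn2r ?nnegrE ?(ltW d0)//.
    exact/ltW/xy.2.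
  move/le_lt_trans; apply.
  rewrite expr_div_n mulrCA gtr_pMr ?exprn_gt0//.
  rewrite ltr_pdivrMr ?exprn_gt0 ?ltr0n// mul1r -natrX ltr_nat.
  by rewrite (leq_trans (ltnSn d))// expnS expn1 leq_pmulr.
apply: eA; split => // i j /=; rewrite ord1.
rewrite /ball /= -(@ltr_pXn2r _ 2) ?nnegrE ?(ltW e0)// real_normK ?num_real//.
apply: le_lt_trans sq_lt; apply: le_trans (orth_proj_nonexpansive x y).
by have := sqr_coord_le_sqnorm (proj x - proj y) j; rewrite !mxE.
Qed.

End euclidean.

(** * Borel measurability on row vectors *)

Notation borel_rV R d := (g_sigma_algebraType (@open 'rV[R]_d)).

Section borel_rV.
Context {R : realType} {d : nat}.

Lemma open_borel_rV (U : set 'rV[R]_d) : open U -> measurable (U : set (borel_rV R d)).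
Proof. exact: sub_sigma_algebra. Qed.

Lemma continuous_measurable_rV (h : 'rV[R]_d -> 'rV[R]_d) :
  continuous h -> measurable_fun setT (h : borel_rV R d -> borel_rV R d).
Proof.
move=> /continuousP ch.
apply: (@measurability _ _ _ (borel_rV R d) _ _ (@open 'rV[R]_d) erefl) => _ [U oU <-].
by rewrite setTI; apply: open_borel_rV; exact: ch.
Qed.

Lemma coord_measurable_rV (i : 'I_d) :
  measurable_fun setT (fun x : borel_rV R d => x ord0 i).
Proof.
apply: (measurability _ (RGenOpens.measurableE R)) => _ [_ [a [b ->]] <-].
rewrite setTI; apply: open_borel_rV.
by move: (@coord_continuous R 1 d ord0 i) => /continuousP; apply; exact: itv_open.
Qed.

Lemma lower_semicontinuous_measurable_rV (f : 'rV[R]_d -> \bar R) :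
  lower_semicontinuous f -> measurable_fun setT (f : borel_rV R d -> \bar R).
Proof.
move=> /lower_semicontinuousP lscf.
apply: (measurability _ (ErealGenOInfty.measurableE R)) => _ [_ [a ->] <-].
by rewrite setTI preimage_itvoy; apply: open_borel_rV; exact: lscf.
Qed.

Context {dT : measure_display} {T : measurableType dT}.

(* Every open set is a countable union of sup-norm balls with rational centre
   and radius 1/(k+1). *)
Lemma measurable_fun_rV (h : T -> 'rV[R]_d) :
  (forall i, measurable_fun setT (fun t => h t ord0 i)) ->
  measurable_fun setT (h : T -> borel_rV R d).
Proof.
move=> mh; apply: (@measurability _ _ _ (borel_rV R d) _ _ (@open 'rV[R]_d) erefl) => _ [U oU <-].
rewrite setTI.
pose box (q : 'rV[rat]_d * nat) : set 'rV[R]_d :=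
  ball (map_mx ratr q.1 : 'rV[R]_d) (q.2.+1%:R^-1).
have -> : U = \bigcup_(q in [set q | box q `<=` U]) box q.
  rewrite eqEsubset; split => [x Ux|x [q /= qU]]; last exact: qU.
  have /nbhs_ballP[e /= e0 eU] : nbhs x U by exact: open_nbhs_nbhs.
  (* Twice the radius must fit below [e], since two points of a box are compared through its
     centre. *)
  have [k ke] : exists k, 2 * k.+1%:R^-1 < e.
    exists (Num.truncn (2 / e)).
    by rewrite ltr_pdivrMr ?ltr0n// mulrC -ltr_pdivrMr//; exact: truncnS_gt.
  have kp : 0 < k.+1%:R^-1 :> R by rewrite invr_gt0 ltr0n.
  have /choice[q qx] (i : 'I_d) : exists r : rat, `|ratr r - x ord0 i| < k.+1%:R^-1.
    have [|r] := @rat_in_itvoo R (x ord0 i - k.+1%:R^-1)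
        (x ord0 i + k.+1%:R^-1).
      by rewrite ltrD2l gtrN.
    by rewrite in_itv/= => /andP[? ?]; exists r; rewrite ltr_distl; apply/andP; split.
  have qx' : box (\row_i q i, k) x.
    by split => //= i j; rewrite ord1 !mxE; exact: qx.
  exists (\row_i q i, k) => //= y qy; apply: eU.
  apply: le_ball (ltW ke) _ _; rewrite mulr_natl mulr2n.
  by apply: ball_triangle qy; exact: ball_sym.
rewrite preimage_bigcup bigcup_mkcond.
apply: countable_bigcupT_measurable => // q; case: ifP => // _.
have -> : h @^-1` box q = \bigcap_(i in [set: 'I_d])
    ((fun t => h t ord0 i) @^-1` ball (ratr (q.1 ord0 i) : R) (q.2.+1%:R^-1)).
  rewrite eqEsubset; split => [t [_ ht]|t].
    by move=> i _ /=; have := ht ord0 i; rewrite mxE.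
  move=> ht; split=> [|i j]; first by rewrite invr_gt0 ltr0n.
  by rewrite ord1 mxE; exact: ht.
apply: fin_bigcap_measurable => // i _; rewrite -[X in measurable X]setTI.
apply: mh => //; apply: measurable_ball.
Qed.

End borel_rV.

(** * Integration over independent variables *)

Section independence.
Context {R : realType} {dO d1 d2 : measure_display} {O : measurableType dO}
  {Y : measurableType d1} {X : measurableType d2}.
Variable P : probability O R.

(** The joint law of [y] and [z] agrees with the product of the law of [y] and [D] on rectangles,
    hence everywhere by uniqueness of product measures; Tonelli then splits the integral. *)
Lemma ge0_integral_indep (D : probability X R) (y : {mfun O >-> Y})
    (z : {mfun O >-> X}) (h : Y * X -> \bar R) :
  (forall A B, measurable A -> measurable B ->
    P (y @^-1` A `&` z @^-1` B) = P (y @^-1` A) * D B)%E ->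
  measurable_fun setT h -> (forall p, 0 <= h p)%E ->
  (\int[P]_w h (y w, z w) = \int[P]_w \int[D]_s h (y w, s))%E.
Proof.
move=> indep mh h0.
have myz : measurable_fun setT (fun w => (y w, z w)) by exact: measurable_fun_pair.
pose yz : {mfun O >-> (Y * X)%type} :=
  HB.pack (fun w => (y w, z w)) (isMeasurableFun.Build _ _ _ _ _ myz).
have law A : measurable A -> (distribution P y \x D)%E A = distribution P yz A.
  apply: product_measure_unique => B C mB mC.
  exact: indep.
rewrite -[LHS](ge0_integral_distribution yz mh h0).
transitivity (\int[distribution P y \x D]_p h p)%E.
  by apply: eq_measure_integral => A mA _; exact/esym/law.
rewrite fubini_tonelli1// (ge0_integral_distribution y)//.
  exact: measurable_fun_fubini_tonelli_F.
by move=> x; exact: integral_ge0.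
Qed.

End independence.

(** * The filtration of the i.i.d. samples *)

Section iid_filtration.
Context {R : realType} {dO dX : measure_display} {O : measurableType dO}
  {X : measurableType dX}.
Variables (P : probability O R) (D : probability X R) (xi : nat -> O -> X).
Hypothesis iid_xi : iid_seq P D xi.

(** A pi-system generating the sigma-algebra of the first [n] samples, in the shape for which
    [iid_seq] gives probabilities. *)
Definition cylinder n : set (set O) :=
  [set E | exists A : nat -> set X,
    (forall i, measurable (A i)) /\ E = \bigcap_(i < n) (xi i @^-1` A i)].

Lemma cylinder_setI_closed n : setI_closed (cylinder n).
Proof.
move=> _ _ [A [mA ->]] [B [mB ->]]; exists (fun i => A i `&` B i).
by split=> [i|]; [exact: measurableI|rewrite -bigcapI].
Qed.

Lemma cylinder_measurable n E : <<s cylinder n >> E -> measurable E.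
Proof.
apply: smallest_sub; first exact: sigma_algebra_measurable.
move=> _ [A [mA ->]]; apply: bigcap_measurableType => i _.
by rewrite -[X in measurable X]setTI; exact: iid_xi.1.
Qed.

Lemma measurable_fun_cylinder (i n : nat) : (i < n)%N ->
  measurable_fun setT (xi i : g_sigma_algebraType (cylinder n) -> X).
Proof.
move=> ltin _ B mB; rewrite setTI; apply: sub_sigma_algebra.
exists (fun j => if j == i then B else setT); split=> [j|].
  by case: ifP.
rewrite eqEsubset; split=> w; last by move/(_ i ltin) => /=; rewrite eqxx.
by move=> Bw j _ /=; case: eqP => // ->.
Qed.

Lemma cylinder_subS n : cylinder n `<=` cylinder n.+1.
Proof.
move=> _ [A [mA ->]].
exists (fun j => if (j < n)%N then A j else setT); split=> [j|].
  by case: ifP.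
rewrite eqEsubset; split=> w h j /= jn; last first.
  by have := h j (ltnW jn) => /=; rewrite jn.
by case: ifP => // /h.
Qed.

(** The product formula holds on cylinders by the i.i.d. hypothesis; the events satisfying it form a
    Dynkin class, so it extends to the generated sigma-algebra. *)
Lemma iid_indep n E B : <<s cylinder n >> E -> measurable B ->
  P (E `&` xi n @^-1` B) = (P E * D B)%E.
Proof.
move=> sE mB; have mC : measurable (xi n @^-1` B).
  by rewrite -[X in measurable X]setTI; exact: iid_xi.1.
have base A : cylinder n A -> P (A `&` xi n @^-1` B) = (P A * D B)%E.
  move=> [F [mF ->]].
  (* Placing [B] at index [n] turns the intersection into a cylinder over [n.+1] samples. *)
  pose G j := if j == n then B else F j.
  have GF j : (j < n)%N -> G j = F j by move=> jn; rewrite /G ltn_eqF.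
  have Gn : G n = B by rewrite /G eqxx.
  have -> : \bigcap_(i < n) (xi i @^-1` F i) `&` xi n @^-1` B =
            \bigcap_(i < n.+1) (xi i @^-1` G i).
    rewrite eqEsubset; split => [w [hF hB] j /=|w h].
      rewrite ltnS leq_eqVlt => /orP[/eqP->|jn]; first by rewrite Gn.
      by rewrite GF//; exact: hF.
    split=> [j /= jn|]; first by rewrite -GF//; exact/h/ltnW.
    by rewrite -Gn; exact: (h n (ltnSn n)).
  rewrite !iid_xi.2//; last by move=> j; rewrite /G; case: ifP.
  by rewrite big_ord_recr /= Gn; congr (_ * _)%E; apply: eq_bigr => i _; rewrite GF.
have setTn : cylinder n setT.
  exists (fun=> setT); split=> //; rewrite eqEsubset; split=> // w _ j _ //.
(* The marginal law of [xi n] is the cylinder case for the whole space. *)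
have PC : P (xi n @^-1` B) = D B.
  by rewrite -[xi n @^-1` B]setTI base// probability_setT mul1e.
pose good (S : set O) := P (S `&` xi n @^-1` B) = (P S * D B)%E.
apply: (@dynkin_induction _ (g_sigma_algebraType (cylinder n)) _ good) sE => //.
- exact: cylinder_setI_closed.
- exact: base.
- move=> S /cylinder_measurable mS gS; rewrite /good.
  have -> : ~` S `&` xi n @^-1` B = xi n @^-1` B `\` (S `&` xi n @^-1` B).
    by rewrite setDIr setDv setU0 setIC -setDE.
  rewrite measureD//; last 2 first.
  - exact: measurableI.
  - by rewrite (le_lt_trans (probability_le1 _ _))// ltry.
  transitivity (D B - P S * D B)%E.
    by rewrite setICA setIid; congr (_ - _)%E; [exact: PC|exact: gS].
  rewrite probability_setC//.
  rewrite muleBl ?mul1e ?fin_num_measure//.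
- move=> F mF tF gF; rewrite /good setI_bigcupl.
  have mFO k : dO.-measurable (F k : set O) by exact: (cylinder_measurable n _ (mF k)).
  rewrite !measure_semi_bigcup//; last 4 first.
  - exact: bigcup_measurable.
  - by move=> k; exact: measurableI.
  - by apply/trivIsetP => a b _ _ ab; rewrite setIACA setIid;
       move/trivIsetP : tF => -> //; rewrite set0I.
  - by apply: bigcup_measurable => k _; exact: measurableI.
  rewrite muleC -(fineK (fin_num_measure D B mB)) -nneseriesZl//.
  apply: eq_eseriesr => k _; rewrite fineK ?fin_num_measure// muleC.
  exact: gF.
Qed.

End iid_filtration.

(** * Measurability of the iterates and independence from the next sample *)

Section psgd_measurability.
Context {R : realType} {d : nat} {dX : measure_display} {X : measurableType dX}.
Variables (proj : 'rV[R]_d -> 'rV[R]_d) (g : 'rV[R]_d -> X -> 'rV[R]_d).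
Hypotheses (cproj : continuous proj) (mg : oracle_measurable g).

Lemma oracle_coord_measurable i :
  measurable_fun setT (fun p : borel_rV R d * X => g p.1 p.2 ord0 i).
Proof.
move=> _ B mB; rewrite setTI; have := mg i B mB.
apply: smallest_sub; first exact: sigma_algebra_measurable.
move=> _ [U [A [oU [mA ->]]]].
by apply: measurableX => //; exact: open_borel_rV.
Qed.

Lemma psgd_update_measurable a :
  measurable_fun setT
    (fun p : borel_rV R d * X => proj (p.1 - a *: g p.1 p.2) : borel_rV R d).
Proof.
apply: (measurableT_comp (continuous_measurable_rV proj cproj)).
apply: measurable_fun_rV => i.
under eq_fun do rewrite !mxE.
apply: measurable_funB.
  exact: (measurableT_comp (coord_measurable_rV i) measurable_fst).
by apply: measurable_funM => //; exact: oracle_coord_measurable.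
Qed.

Lemma sqnorm_sub_measurable y :
  measurable_fun setT (fun x : borel_rV R d => sqnorm (x - y)).
Proof.
rewrite /sqnorm /dotp; under eq_fun do under eq_bigr do rewrite !mxE.
apply: (measurable_sum _ (h := fun i (x : borel_rV R d) =>
  (x ord0 i - y ord0 i) * (x ord0 i - y ord0 i))) => i.
by apply: measurable_funM; apply: measurable_funB => //; exact: coord_measurable_rV.
Qed.

Context {dO : measure_display} {O : measurableType dO}.
Variables (P : probability O R) (D : probability X R) (xi : nat -> O -> X).
Hypothesis iid_xi : iid_seq P D xi.
Variables (alpha : nat -> R) (x0 : 'rV[R]_d).

(** The codomain is typed as [borel_rV R d] so that measurability refers to the Borel
    sigma-algebra. *)
Definition iterate k w : borel_rV R d := psgd proj g alpha x0 (fun j => xi j w) k.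

(** The next iterate is a measurable function of [iterate k] and [xi k]; in the induction,
    measurability passes to the larger sigma-algebra of [k.+1] samples. *)
Lemma iterate_adapted k :
  measurable_fun setT (iterate k : g_sigma_algebraType (cylinder xi k) -> _).
Proof.
elim: k => [|k IH]; first exact: measurable_cst.
apply: (measurableT_comp (psgd_update_measurable (alpha k))
  (g := fun w : g_sigma_algebraType (cylinder xi k.+1) => (iterate k w, xi k w))).
apply: measurable_fun_pair; last exact: measurable_fun_cylinder.
move=> _ B mB; have := IH measurableT B mB.
by apply: sub_smallest2r => //; exact: cylinder_subS.
Qed.

Lemma iterate_measurable k : measurable_fun setT (iterate k).
Proof.
move=> _ B mB; have := iterate_adapted k measurableT B mB.
exact: (cylinder_measurable P D).
Qed.

Lemma iterate_indep k A B : measurable A -> measurable B ->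
  P (iterate k @^-1` A `&` xi k @^-1` B) = (P (iterate k @^-1` A) * D B)%E.
Proof.
move=> mA mB; apply: (iid_indep P D xi) => //.
by have := iterate_adapted k measurableT A mA; rewrite setTI.
Qed.

(** Stands in for conditioning on the past: the fresh sample is integrated out with the current
    iterate frozen. *)
Lemma ge0_integral_iterate k (h : borel_rV R d * X -> \bar R) :
  measurable_fun setT h -> (forall p, 0 <= h p)%E ->
  (\int[P]_w h (iterate k w, xi k w) =
   \int[P]_w \int[D]_s h (iterate k w, s))%E.
Proof.
move=> mh h0.
pose y : {mfun O >-> borel_rV R d} := HB.pack (iterate k)
  (isMeasurableFun.Build _ _ _ _ _ (iterate_measurable k)).
pose z : {mfun O >-> X} := HB.pack (xi k)
  (isMeasurableFun.Build _ _ _ _ _ (iid_xi.1 k)).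
by apply: (ge0_integral_indep P D y z) => // A B; exact: iterate_indep.
Qed.

End psgd_measurability.

(** * Expected progress of one step from a fixed point *)

Lemma integral_probability_cst (R : realType) (dT : measure_display)
    (T : measurableType dT) (P : probability T R) (c : \bar R) :
  (\int[P]_w c = c)%E.
Proof.
by rewrite (integral_cst P measurableT) [X in (_ * X)%E](probability_setT P) mule1.
Qed.

Section one_step.
Context {R : realType} {d : nat} {dX : measure_display} {X : measurableType dX}.
Variables (D : probability X R) (g : 'rV[R]_d -> X -> 'rV[R]_d) (x : 'rV[R]_d).
Hypothesis ig : oracle_integrable D g x.

Lemma dotp_oracle_integral u :
  D.-integrable setT (fun s => (dotp u (g x s))%:E) /\
  (\int[D]_s (dotp u (g x s))%:E = (dotp u (oracle_mean D g x))%:E)%E.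
Proof.
(* Induction on the index list proves integrability and the value together, as additivity of the
   integral needs integrability of the tail. *)
pose p v s := (\sum_(i <- v) u ord0 i * g x s ord0 i).
rewrite /dotp -!/(p (index_enum _) _).
elim: (index_enum _) => [|i v [IHi IHv]].
  rewrite big_nil; split.
    by apply: eq_integrable (integrable0 _ _) => // s _; rewrite /p big_nil.
  by apply: integral0_eq => s _; rewrite /p big_nil.
have -> : (fun s => (p (i :: v) s)%:E) =
    (fun s => (u ord0 i)%:E * (g x s ord0 i)%:E + (p v s)%:E)%E.
  by apply/funext => s; rewrite /p big_cons.
have ii := integrableZl measurableT (u ord0 i) (ig i).
rewrite big_cons; split; first exact: integrableD.
rewrite (integralD measurableT ii IHi) (integralZl measurableT (ig i)).
rewrite IHv EFinD EFinM mxE fineK//.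
exact: integrable_fin_num.
Qed.

Lemma sqnorm_oracle_integrable (C : R) :
  (\int[D]_s (sqnorm (g x s))%:E <= C%:E)%E ->
  D.-integrable setT (fun s => (sqnorm (g x s))%:E).
Proof.
move=> gC; apply/integrableP; split.
  apply/measurable_EFinP.
  apply: (measurable_sum _ (h := fun i s => g x s ord0 i * g x s ord0 i)) => i.
  by apply: measurable_funM; apply/measurable_EFinP; have [] := integrableP _ _ _ (ig i).
under eq_integral do rewrite gee0_abs ?lee_fin ?sqnorm_ge0//.
by rewrite (le_lt_trans gC)// ltry.
Qed.

Context {Q : set 'rV[R]_d} {proj : 'rV[R]_d -> 'rV[R]_d} {f : 'rV[R]_d -> \bar R}.
Hypotheses (cvxQ : convex_subset Q) (projP : is_orth_proj Q proj).
Hypothesis (mg : oracle_measurable g).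
Variables (xstar : 'rV[R]_d) (fx fstar mu L0 L1 : R).
Hypotheses (Qx : Q x) (Qxstar : Q xstar).
Hypotheses (fxE : f x = fx%:E) (fstarE : f xstar = fstar%:E).
Hypotheses (hsc : strongly_convex_on mu Q f) (hsub : subdiff f x (oracle_mean D g x)).
Hypothesis hvar :
  (\int[D]_s (sqnorm (g x s))%:E <= (L0 ^+ 2 + L1 * (fx - fstar))%:E)%E.

Lemma one_step_bound a : 0 <= a ->
  (\int[D]_s (sqnorm (proj (x - a *: g x s) - xstar))%:E <=
   ((1 - mu * a) * sqnorm (x - xstar) - a * (2 - L1 * a) * (fx - fstar)
     + a ^+ 2 * L0 ^+ 2)%:E)%E.
Proof.
move=> a0.
have [iu Eu] := dotp_oracle_integral (- (2 * a) *: (x - xstar)).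
have isq := sqnorm_oracle_integrable _ hvar.
have sub := hsub; set m := oracle_mean D g x in sub Eu.
(* Strong convexity at [x], tested at [xstar], with the mean of the oracle as subgradient. *)
have sc : fx + dotp m (xstar - x) + mu / 2 * sqnorm (x - xstar) <= fstar.
  have := hsc _ _ Qx sub _ Qxstar; rewrite fxE fstarE -EFinD lee_fin.
  by rewrite -(opprB x xstar) sqnormN addrA.
have FE s : (sqnorm (x - a *: g x s - xstar))%:E =
    ((sqnorm (x - xstar))%:E + ((dotp (- (2 * a) *: (x - xstar)) (g x s))%:E
     + (a ^+ 2)%:E * (sqnorm (g x s))%:E))%E.
  have -> : x - a *: g x s - xstar = x - xstar - a *: g x s by rewrite addrAC.
  rewrite [in LHS]sqnormB sqnormZ dotpZr dotpZl -EFinM -!EFinD; congr EFin.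
  by ring.
have icst : D.-integrable setT (cst (sqnorm (x - xstar))%:E).
  exact: finite_measure_integrable_cst.
have isqa := integrableZl measurableT (a ^+ 2) isq.
have iF : D.-integrable setT (fun s => (sqnorm (x - a *: g x s - xstar))%:E).
  by under eq_fun do rewrite FE; do 2 (apply: integrableD => //).
have cproj := orth_proj_continuous cvxQ projP.
(* Since [xstar] lies in [Q], dropping the projection can only increase the distance; what remains
   expands into constant, linear and quadratic terms in [g x s]. *)
apply: (@le_trans _ _ (\int[D]_s (sqnorm (x - a *: g x s - xstar))%:E)%E).
  apply: ge0_le_integral => //.
  - by move=> s _; rewrite lee_fin sqnorm_ge0.
  - apply/measurable_EFinP.
    apply: (measurableT_comp (sqnorm_sub_measurable xstar)
      (g := fun s => proj (x - a *: g x s) : borel_rV R d)).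
    exact: (measurableT_comp (psgd_update_measurable proj g cproj mg a)
      (pair1_measurable (x : borel_rV R d))).
  - by have [] := integrableP _ _ _ iF.
  - by move=> s _; rewrite lee_fin (orth_proj_sqnorm_le cvxQ projP).
under eq_integral do rewrite FE.
rewrite integralD//; last exact: integrableD.
rewrite integralD// integralZl// integral_probability_cst Eu.
have a2 : (0 <= (a ^+ 2)%:E)%E by rewrite lee_fin sqr_ge0.
have var := lee_wpmul2l a2 hvar.
apply: le_trans (leeD2l _ (leeD2l _ var)) _.
rewrite -EFinM -!EFinD lee_fin dotpZl dotpC.
move: sc; rewrite -(opprB x xstar) dotpNr => sc.
have := ler_wpM2l a0 sc.
set c := dotp _ _; set q := sqnorm _ => h.
by nra.
Qed.

End one_step.

(** * Algebra of the step sizes *)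

Section step_size.
Context {R : realType}.
Variables (mu L1 : R).
Hypothesis mu0 : 0 < mu.

(* Equal to k / step (k - 1) for k > 0, see potential_coef_step. *)
Definition potential_coef (k : nat) : R := (mu * k%:R * k.+1%:R + L1 ^+ 2 / mu) / 2.

Let den_gt0 k : 0 < mu * k.+2%:R + L1 ^+ 2 / (mu * k.+1%:R).
Proof.
by rewrite ltr_pwDl ?mulr_gt0 ?ltr0n// divr_ge0 ?sqr_ge0// mulr_ge0 ?ler0n ?ltW.
Qed.

Lemma potential_coef_ge0 k : 0 <= potential_coef k.
Proof.
apply: divr_ge0 => //; apply: addr_ge0; last by rewrite divr_ge0 ?sqr_ge0 ?ltW.
by do 2 (apply: mulr_ge0 => //); exact: ltW.
Qed.

Lemma step_gt0 k : 0 < step mu L1 k.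
Proof. by rewrite divr_gt0. Qed.

(** The denominator of [step], multiplied by [k.+1] and halved, is exactly [potential_coef k.+1]. *)
Lemma potential_coef_step k : potential_coef k.+1 * step mu L1 k = k.+1%:R.
Proof.
have d0 := lt0r_neq0 (den_gt0 k).
have k0 : k.+1%:R != 0 :> R by rewrite pnatr_eq0.
have -> : potential_coef k.+1 =
    k.+1%:R * (mu * k.+2%:R + L1 ^+ 2 / (mu * k.+1%:R)) / 2.
  rewrite /potential_coef -[k.+1.+1%:R]natr1; move: k.+1%:R k0 => n n0.
  by field; rewrite n0 gt_eqF.
rewrite /step; move: (_ + _ / _) d0 => den den0.
by field.
Qed.

(** The telescoping identity: the product with [step] reduces to [k.+1], and
    [(k+1)(k+2) - 2(k+1) = k(k+1)]. *)
Lemma potential_coef_rec k :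
  potential_coef k.+1 * (1 - mu * step mu L1 k) = potential_coef k.
Proof.
rewrite mulrBr mulr1 mulrCA potential_coef_step /potential_coef.
by rewrite -[k.+1.+1%:R]natr1 -[k.+1%:R]natr1; field; rewrite gt_eqF.
Qed.

Lemma mulr_step_le k : k.+1%:R * step mu L1 k <= 2 / mu.
Proof.
rewrite /step mulrA ler_pdivrMr// [leRHS]mulrAC ler_pdivlMr//.
have k0 : 0 <= k.+1%:R :> R by rewrite ler0n.
have q0 : 0 <= L1 ^+ 2 / (mu * k.+1%:R).
  by rewrite divr_ge0 ?sqr_ge0// mulr_ge0 ?(ltW mu0).
rewrite -[k.+1.+1%:R]natr1; move: (_ / _) q0 => q q0. have := mu0; nra.
Qed.

(** With [u = mu * k.+1], completing the square gives [2 * L1 <= u + L1 ^+ 2 / u], and the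
    denominator exceeds the right side by [mu]. *)
Lemma mulr_step_le1 k : L1 * step mu L1 k <= 1.
Proof.
rewrite /step mulrA ler_pdivrMr// mul1r.
have k0 : 0 < k.+1%:R :> R by rewrite ltr0n.
rewrite -[k.+1.+1%:R]natr1; set u := mu * k.+1%:R.
have u0 : 0 < u by rewrite mulr_gt0.
have -> : mu * (k.+1%:R + 1) + L1 ^+ 2 / u = L1 * 2 + (mu + (u - L1) ^+ 2 / u).
  by rewrite mulrDr mulr1 -/u; field; rewrite gt_eqF.
by rewrite lerDl addr_ge0 ?(ltW mu0)// divr_ge0 ?sqr_ge0 ?ltW.
Qed.

End step_size.

(** * Jensen's inequality for finite weighted averages *)

Lemma jensen_sum (R : realType) d (f : 'rV[R]_d -> \bar R) (Q : set 'rV[R]_d)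
    (phi : 'rV[R]_d -> R) (v : nat -> R) (y : nat -> 'rV[R]_d) n :
  ext_convex f -> convex_subset Q -> (forall x, Q x -> f x = (phi x)%:E) ->
  (forall k, 0 < v k) -> (forall k, Q (y k)) ->
  let V := \sum_(k < n.+1) v k in
  let a := V^-1 *: \sum_(k < n.+1) v k *: y k in
  Q a /\ V * phi a <= \sum_(k < n.+1) v k * phi (y k).
Proof.
(* Each new average is a convex combination of the previous one and the new point. Membership in [Q]
   is carried along because [phi] represents [f] only there. *)
move=> cf cQ fphi v0 Qy; elim: n => [|n [IHQ IHf]].
  by rewrite !big_ord1 /= scalerA mulVf ?lt0r_neq0// scale1r; split.
move=> V' a'; rewrite {}/a' {}/V'.
rewrite big_ord_recr/= [X in _ *: X]big_ord_recr/= [X in _ <= X]big_ord_recr/=.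
set V := \sum_(k < n.+1) v k in IHQ IHf *; set S := \sum_(k < n.+1) _ *: _ in IHQ IHf *.
have V0 : 0 < V by rewrite /V big_ord_recr/= ltr_wpDl// sumr_ge0// => k _; exact: ltW.
have W0 : 0 < V + v n.+1 by rewrite addr_gt0.
pose t := V / (V + v n.+1).
have t01 : 0 <= t <= 1.
  by rewrite divr_ge0 ?(ltW V0) ?(ltW W0)//= ler_pdivrMr// mul1r lerDl ltW.
have tE : 1 - t = v n.+1 / (V + v n.+1).
  by rewrite /t; field; rewrite gt_eqF.
have -> : (V + v n.+1)^-1 *: (S + v n.+1 *: y n.+1) =
    t *: (V^-1 *: S) + (1 - t) *: y n.+1.
  rewrite tE scalerDr !scalerA; congr (_ *: _ + _ *: _); last by rewrite mulrC.
  by rewrite /t; field; rewrite !gt_eqF.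
have Qa := cQ _ _ _ IHQ (Qy n.+1) t01.
split=> //; have := cf (V^-1 *: S) (y n.+1) t t01.
rewrite !fphi// -!EFinM -EFinD lee_fin => /(ler_wpM2l (ltW W0)) /le_trans; apply.
have Wt : (V + v n.+1) * t = V by rewrite /t mulrC divfK// gt_eqF.
have Wu : (V + v n.+1) * (1 - t) = v n.+1 by rewrite tE mulrC divfK// gt_eqF.
by rewrite mulrDr [_ * (t * _)]mulrA [_ * ((1 - t) * _)]mulrA Wt Wu lerD2r.
Qed.

(** * The expected recursion and its summation *)

Section convergence.
Context {R : realType} {d : nat} {f : 'rV[R]_d -> \bar R} {Q : set 'rV[R]_d}
  {dX dO : measure_display} {X : measurableType dX} {O : measurableType dO}
  {D : probability X R} {P : probability O R} {g : 'rV[R]_d -> X -> 'rV[R]_d}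
  {proj : 'rV[R]_d -> 'rV[R]_d} {xi : nat -> O -> X}
  {xstar x0 : 'rV[R]_d} {fstar mu L0 L1 : R}.
Hypotheses (hf_ninf : forall x, f x != -oo%E) (hf_lsc : lower_semicontinuous f)
  (hf_conv : ext_convex f) (hQconv : convex_subset Q)
  (hQdom : forall x, Q x -> (f x < +oo)%E)
  (hxstarQ : Q xstar) (hxstar_min : forall y, Q y -> (f xstar <= f y)%E)
  (hfstar : f xstar = fstar%:E)
  (hmu : 0 < mu) (hsc : strongly_convex_on mu Q f)
  (hg_meas : oracle_measurable g)
  (hg_int : forall x, Q x -> oracle_integrable D g x)
  (hg_sub : forall x, Q x -> subdiff f x (oracle_mean D g x))
  (hg_var : forall x, Q x ->
     (\int[D]_xi (sqnorm (g x xi))%:E <= (L0 ^+ 2 + L1 * (fine (f x) - fstar))%:E)%E)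
  (hx0 : Q x0) (hproj : is_orth_proj Q proj) (hxi : iid_seq P D xi).

Let alpha := step mu L1.
Let A := potential_coef mu L1.
Let x k w := iterate proj g xi alpha x0 k w.
Let wgt k : R := k.+1%:R * (2 - L1 * alpha k).

Let fQ z : Q z -> f z = (fine (f z))%:E.
Proof. by move=> Qz; rewrite fineK// fin_numE hf_ninf/= -ltey hQdom. Qed.

Let gap_ge0 z : Q z -> (0 <= f z - fstar%:E)%E.
Proof. by move=> Qz; rewrite sube_ge0 ?fin_numE// -hfstar hxstar_min. Qed.

Lemma iterate_in k w : Q (x k w).
Proof. by case: k => [|k] //; exact: (hproj _).1. Qed.

Let mx k : measurable_fun setT (x k).
Proof.
exact: (iterate_measurable _ _ (orth_proj_continuous hQconv hproj) hg_meas P D _ hxi).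
Qed.

Let gap_measurable (z : O -> borel_rV R d) : measurable_fun setT z ->
  measurable_fun setT (fun w => (f (z w) - fstar%:E)%E).
Proof.
move=> mz; apply: emeasurable_funB => //.
exact: (measurableT_comp (lower_semicontinuous_measurable_rV f hf_lsc)).
Qed.

Let dist_measurable k :
  measurable_fun setT (fun w => (sqnorm (x k w - xstar))%:E).
Proof.
by apply/measurable_EFinP; exact: (measurableT_comp (sqnorm_sub_measurable xstar)).
Qed.

Let wgt_ge k : k.+1%:R <= wgt k.
Proof.
rewrite /wgt ler_peMr ?ler0n//.
by have := mulr_step_le1 _ L1 hmu k; rewrite -/(alpha k); lra.
Qed.

Lemma potential_decrease k :
  ((A k.+1)%:E * \int[P]_w (sqnorm (x k.+1 w - xstar))%:E
     + (wgt k)%:E * \int[P]_w (f (x k w) - fstar%:E)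
   <= (A k)%:E * \int[P]_w (sqnorm (x k w - xstar))%:E + (2 * L0 ^+ 2 / mu)%:E)%E.
Proof.
have cproj := orth_proj_continuous hQconv hproj.
have A0 j : 0 <= A j by exact: potential_coef_ge0.
have w0 : 0 <= wgt k := le_trans (ler0n _ _) (wgt_ge k).
pose h (p : borel_rV R d * X) :=
  (sqnorm (proj (p.1 - alpha k *: g p.1 p.2) - xstar))%:E.
have h0 p : (0 <= h p)%E by rewrite lee_fin sqnorm_ge0.
have mh : measurable_fun setT h.
  apply/measurable_EFinP; apply: (measurableT_comp (sqnorm_sub_measurable xstar)).
  exact: (psgd_update_measurable proj g cproj hg_meas).
pose H w := (\int[D]_s h (x k w, s))%E.
have H0 w : (0 <= H w)%E by exact: integral_ge0.
have mH : measurable_fun setT H.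
  exact: (measurableT_comp (measurable_fun_fubini_tonelli_F (m2 := D) h mh h0) (mx k)).
have c0 : 0 <= 2 * L0 ^+ 2 / mu.
  by apply: divr_ge0; [apply: mulr_ge0 => //; exact: sqr_ge0|exact: ltW].
have mgap := gap_measurable _ (mx k).
have -> : (\int[P]_w (sqnorm (x k.+1 w - xstar))%:E = \int[P]_w H w)%E.
  exact: (ge0_integral_iterate _ _ cproj hg_meas P D _ hxi).
have gap0 w : setT w -> (0 <= f (x k w) - fstar%:E)%E.
  by move=> _; exact/gap_ge0/iterate_in.
have sq0 w : setT w -> (0 <= (sqnorm (x k w - xstar))%:E)%E.
  by rewrite lee_fin sqnorm_ge0.
rewrite -!ge0_integralZl_EFin//.
(* Writing the constant as an integral reduces the claim to a pointwise inequality in [w]. *)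
rewrite -[X in (_ <= _ + X)%E](integral_probability_cst _ _ _ P).
have t1 w : setT w -> (0 <= (A k.+1)%:E * H w)%E.
  by move=> _; rewrite mule_ge0 ?lee_fin.
have t2 w : setT w -> (0 <= (wgt k)%:E * (f (x k w) - fstar%:E))%E.
  by move=> _; rewrite mule_ge0 ?lee_fin ?gap0.
have t3 w : setT w -> (0 <= (A k)%:E * (sqnorm (x k w - xstar))%:E)%E.
  by move=> _; rewrite mule_ge0 ?lee_fin ?sqnorm_ge0.
have m1 := measurable_funeM (A k.+1)%:E mH.
have m2 := measurable_funeM (wgt k)%:E mgap.
have m3 := measurable_funeM (A k)%:E (dist_measurable k).
rewrite -!ge0_integralD//.
apply: ge0_le_integral => //.
- by move=> w Tw; rewrite adde_ge0 ?t1 ?t2.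
- exact: emeasurable_funD.
- exact: emeasurable_funD.
move=> w _; have Qx := iterate_in k w.
have a0 : 0 <= alpha k by exact/ltW/step_gt0.
have := one_step_bound _ _ _ (hg_int _ Qx) hQconv hproj hg_meas _ _ _ _ L0 L1
  Qx hxstarQ (fQ _ Qx) hfstar hsc (hg_sub _ Qx) (hg_var _ Qx) _ a0.
set del := fine (f (x k w)) - fstar; set q := sqnorm _ => bnd.
rewrite (fQ _ Qx) -EFinB -/del.
have Ak0 : (0 <= (A k.+1)%:E)%E by rewrite lee_fin.
apply: le_trans (leeD2r _ (lee_wpmul2l Ak0 bnd)) _.
rewrite -!EFinM -!EFinD lee_fin.
have Ea := potential_coef_step _ L1 hmu k.
have Er := potential_coef_rec _ L1 hmu k.
have le := mulr_step_le _ L1 hmu k.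
rewrite -/A -/alpha in Ea Er le.
(* After regrouping, the distance coefficient becomes [A k], the gap terms cancel since [wgt k = A
   k.+1 * alpha k * (2 - L1 * alpha k)], and the noise is [k.+1 * alpha k * L0 ^+ 2]. *)
have -> : A k.+1 * ((1 - mu * alpha k) * q - alpha k * (2 - L1 * alpha k) * del +
   alpha k ^+ 2 * L0 ^+ 2) + wgt k * del =
   A k.+1 * (1 - mu * alpha k) * q + (wgt k - A k.+1 * alpha k * (2 - L1 * alpha k)) * del
   + A k.+1 * alpha k * alpha k * L0 ^+ 2 by ring.
rewrite Er Ea subrr mul0r addr0 lerD2l [leRHS]mulrAC.
by rewrite ler_wpM2r// sqr_ge0.
Qed.

Lemma weighted_gap_sum n :
  (\sum_(k < n) (wgt k)%:E * \int[P]_w (f (x k w) - fstar%:E) <=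
   (L1 ^+ 2 * sqnorm (x0 - xstar) / (2 * mu) + 2 * L0 ^+ 2 * n%:R / mu)%:E)%E.
Proof.
have A0 j : 0 <= A j by exact: potential_coef_ge0.
(* The induction needs the potential term on the left; being nonnegative, it is discarded at the
   end. *)
suff : ((A n)%:E * \int[P]_w (sqnorm (x n w - xstar))%:E +
   \sum_(k < n) (wgt k)%:E * \int[P]_w (f (x k w) - fstar%:E) <=
   (L1 ^+ 2 * sqnorm (x0 - xstar) / (2 * mu) + 2 * L0 ^+ 2 * n%:R / mu)%:E)%E.
  apply: le_trans; rewrite leeDr// mule_ge0 ?lee_fin//.
  by apply: integral_ge0 => w _; rewrite lee_fin sqnorm_ge0.
elim: n => [|n IH].
  rewrite big_ord0 adde0.
  rewrite [X in (_ * X)%E](integral_probability_cst _ _ _ P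
    (sqnorm (x0 - xstar))%:E).
  rewrite -EFinM lee_fin.
  (* At index 0 the coefficient is [L1 ^+ 2 / (2 * mu)], the source of the initial-distance term. *)
  rewrite /A /potential_coef mulr0 mul0r add0r mulr0 mul0r addr0 le_eqVlt.
  by apply/orP; left; apply/eqP; field; rewrite gt_eqF.
rewrite big_ord_recr/= addeC -addeA [X in (_ + X)%E]addeC.
apply: le_trans (leeD2l _ (potential_decrease n)) _.
rewrite addeA [X in (X + _)%E]addeC.
apply: le_trans (leeD2r _ IH) _.
rewrite -EFinD lee_fin -addrA lerD2l -mulrDl ler_pM2r ?invr_gt0//.
by rewrite -[n.+1%:R]natr1 mulrDr mulr1.
Qed.

(** Jensen bounds the gap of the average by the averaged gaps; these are nonnegative, so [v] may be
    enlarged to [wgt] before summing. Leaving [v] free covers both averages. *)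
Lemma averaged_gap_le (v : nat -> R) n (V := \sum_(k < n.+1) v k) :
  (forall k, 0 < v k) -> (forall k, v k <= wgt k) ->
  (\int[P]_w (f (V^-1 *: \sum_(k < n.+1) v k *: x k w) - fstar%:E) <=
   (V^-1 * (L1 ^+ 2 * sqnorm (x0 - xstar) / (2 * mu) + 2 * L0 ^+ 2 * n.+1%:R / mu))%:E)%E.
Proof.
move=> v0 vw.
have V0 : 0 < V by rewrite /V big_ord_recr/= ltr_wpDl// sumr_ge0// => k _; exact: ltW.
have Vi0 : (0 <= V^-1%:E)%E by rewrite lee_fin invr_ge0 ltW.
have vE0 k : (0 <= (v k)%:E)%E by rewrite lee_fin ltW.
have mavg : measurable_fun setT
    (fun w => V^-1 *: \sum_(k < n.+1) v k *: x k w : borel_rV R d).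
  apply: measurable_fun_rV => i.
  under eq_fun do rewrite mxE summxE.
  apply: measurable_funM => //.
  apply: (measurable_sum _ (h := fun (k : 'I_n.+1) w => (v k *: x k w) ord0 i)) => k.
  under eq_fun do rewrite mxE.
  apply: measurable_funM => //.
  exact: (measurableT_comp (coord_measurable_rV i) (mx k)).
have gap0 k w : (0 <= f (x k w) - fstar%:E)%E by exact/gap_ge0/iterate_in.
have mgap k := gap_measurable _ (mx k).
have jen w := jensen_sum _ _ f Q (fun z => fine (f z)) v (fun k => x k w) n
  hf_conv hQconv fQ v0 (fun k => iterate_in k w).
have msum : measurable_fun setT
    (fun w => \sum_(k < n.+1) (v k)%:E * (f (x k w) - fstar%:E))%E.
  by apply: emeasurable_sum => k; exact: measurable_funeM.
apply: (@le_trans _ _ (\int[P]_w (V^-1%:E *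
    \sum_(k < n.+1) (v k)%:E * (f (x k w) - fstar%:E)))%E).
  apply: ge0_le_integral => //.
  - by move=> w _; apply: gap_ge0; exact: (jen w).1.
  - exact: gap_measurable.
  - exact: measurable_funeM.
  move=> w _; have [Qa le] := jen w.
  rewrite (fQ _ Qa) -EFinB.
  have -> : (\sum_(k < n.+1) (v k)%:E * (f (x k w) - fstar%:E) =
      (\sum_(k < n.+1) v k * (fine (f (x k w)) - fstar))%:E)%E.
    rewrite -sumEFin; apply: eq_bigr => k _.
    by rewrite EFinM EFinB -fQ//; exact: iterate_in.
  rewrite -EFinM lee_fin ler_pdivlMl// mulrBr.
  rewrite [leRHS](_ : _ = \sum_(k < n.+1) v k * fine (f (x k w)) - V * fstar).
    by rewrite lerD2r.
  by rewrite /V mulr_suml -sumrB; apply: eq_bigr => k _; rewrite mulrBr.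
have sum0 w : (0 <= \sum_(k < n.+1) (v k)%:E * (f (x k w) - fstar%:E))%E.
  by apply: sume_ge0 => k _; rewrite mule_ge0.
rewrite (ge0_integralZl_EFin P measurableT (fun w _ => sum0 w) msum Vi0).
rewrite (ge0_integral_sum P measurableT
  (fun k : 'I_n.+1 => measurable_funeM (v k)%:E (mgap k))
  (fun k w _ => mule_ge0 (vE0 k) (gap0 k w))).
rewrite EFinM. apply: (lee_wpmul2l Vi0).
apply: le_trans (weighted_gap_sum n.+1).
apply: lee_sum => k _; rewrite (ge0_integralZl_EFin P measurableT
  (fun w _ => gap0 k w) (mgap k) (ltW (v0 k))).
apply: lee_wpmul2r; last by rewrite lee_fin.
by apply: integral_ge0 => w _; exact: gap0.
Qed.

End convergence.

(** * Both averages as choices of the weights *)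

Theorem theorem1p7
  (R : realType) (d : nat)
  (* the objective f : R^d -> R \cup {+oo}, lower semicontinuous and convex *)
  (f : 'rV[R]_d -> \bar R)
  (hf_ninf : forall x, f x != -oo%E)
  (hf_lsc : lower_semicontinuous f)
  (hf_conv : ext_convex f)
  (* the feasible set Q: nonempty, closed, convex, contained in dom f *)
  (Q : set 'rV[R]_d)
  (hQ0 : Q !=set0) (hQcl : closed Q) (hQconv : convex_subset Q)
  (hQdom : forall x, Q x -> (f x < +oo)%E)
  (* a fixed minimizer xstar of f over Q, with minimum value fstar *)
  (xstar : 'rV[R]_d) (fstar : R)
  (hxstarQ : Q xstar) (hxstar_min : forall y, Q y -> (f xstar <= f y)%E)
  (hfstar : f xstar = fstar%:E)
  (* strong convexity on Q *)
  (mu : R) (hmu : 0 < mu) (hsc : strongly_convex_on mu Q f)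
  (* the stochastic subgradient oracle *)
  (dX : measure_display) (X : measurableType dX) (D : probability X R)
  (g : 'rV[R]_d -> X -> 'rV[R]_d)
  (hg_meas : oracle_measurable g)
  (hg_int : forall x, Q x -> oracle_integrable D g x)
  (hg_sub : forall x, Q x -> subdiff f x (oracle_mean D g x))
  (L0 L1 : R) (hL0 : 0 <= L0) (hL1 : 0 <= L1)
  (hg_var : forall x, Q x ->
     (\int[D]_xi (sqnorm (g x xi))%:E <= (L0 ^+ 2 + L1 * (fine (f x) - fstar))%:E)%E)
  (* starting point and the orthogonal projection onto Q *)
  (x0 : 'rV[R]_d) (hx0 : Q x0)
  (proj : 'rV[R]_d -> 'rV[R]_d) (hproj : is_orth_proj Q proj)
  (* i.i.d. samples xi_0, xi_1, ... ~ D on a probability space *)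
  (dO : measure_display) (O : measurableType dO) (P : probability O R)
  (xi : nat -> O -> X) (hxi : iid_seq P D xi)
  (T : nat) :
  let alpha := step mu L1 in
  let x k w := psgd proj g alpha x0 (fun j => xi j w) k in
  let wgt k := (k.+1)%:R * (2 - L1 * alpha k) in
  let W := \sum_(k < T.+1) wgt k in
  (\int[P]_w (f (W^-1 *: \sum_(k < T.+1) wgt k *: x k w) - fstar%:E)
     <= ((2 * L0 ^+ 2 * T.+1%:R + L1 ^+ 2 * sqnorm (x0 - xstar) / 2) / (mu * W))%:E)%E
  /\
  (\int[P]_w (f ((2 / (T.+1%:R * T.+2%:R)) *: \sum_(k < T.+1) k.+1%:R *: x k w) - fstar%:E)
     <= (4 * L0 ^+ 2 / (mu * T.+2%:R)
         + L1 ^+ 2 * sqnorm (x0 - xstar) / (mu * T.+1%:R * T.+2%:R))%:E)%E.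
Proof.
move=> alpha x wgt W.
have avg := averaged_gap_le hf_ninf hf_lsc hf_conv hQconv hQdom hxstarQ hxstar_min
  hfstar hmu hsc hg_meas hg_int hg_sub hg_var hx0 hproj hxi.
have aL k : L1 * alpha k <= 1 := mulr_step_le1 _ L1 hmu k.
have k0 k : 0 < k.+1%:R :> R by rewrite ltr0n.
have wgt_ge k : k.+1%:R <= wgt k.
  by rewrite /wgt ler_peMr ?ler0n//; have := aL k; lra.
split.
- apply: le_trans (avg wgt T _ _) _ => //.
    by move=> k; exact: lt_le_trans (wgt_ge k).
  rewrite lee_fin -/W le_eqVlt; apply/orP; left; apply/eqP.
  have W0 : W != 0.
    rewrite gt_eqF// /W big_ord_recr/= ltr_wpDl//.
      by apply: sumr_ge0 => k _; exact: le_trans (wgt_ge k).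
    exact: lt_le_trans (wgt_ge T).
  by field; rewrite W0 gt_eqF.
(* The total of the weights [k.+1], whose inverse is the normalising factor of the second
   average. *)
have sumk : \sum_(k < T.+1) k.+1%:R = T.+1%:R * T.+2%:R / 2 :> R.
  elim: (T.+1) => [|n IH]; first by rewrite big_ord0 mul0r mul0r.
  by rewrite big_ord_recr/= IH -[n.+2%:R]natr1 -[n.+1%:R]natr1; field.
have := avg (fun k => k.+1%:R) T k0 wgt_ge.
rewrite sumk invf_div => /le_trans; apply.
rewrite lee_fin le_eqVlt; apply/orP; left; apply/eqP.
move: (lt0r_neq0 (k0 T)) (lt0r_neq0 (k0 T.+1)).
by move: T.+1%:R T.+2%:R => a b a0 b0; field; rewrite a0 b0 gt_eqF.
Qed.
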